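(* Let $n\ge2$, let $\lambda_1\ge\dots\ge\lambda_n$ be real, and let $\mu_1\ge\dots\ge\mu_{n-1}$ be the critical points (with multiplicity) of $q(x)=\prod_{j=1}^n(x-\lambda_j)$. Let $N=n(n-1)$ and define $\lambda^*,\mu^*,\nu^*\in\mathbb R^N$ by: $\lambda^*$ consists of each $\lambda_j$ ($j=1,\dots,n$) repeated $n-1$ times; $\mu^*$ consists of each $\mu_k$ ($k=1,\dots,n-1$) repeated $n$ times; $\nu^*$ consists of each $\nu_j:=\frac{n-1}{n}\lambda_{j+1}+\frac1n\lambda_1$ ($j=1,\dots,n-1$) repeated $n$ times. Then $\nu^*\prec\mu^*\prec\lambda^*$. Moreover there exists a doubly stochastic $N\times N$ matrix $D$ with $\mu^*=D\lambda^*$.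
   Context: For $x\in\mathbb R^N$, $x^{\downarrow}$ denotes the rearrangement of $x$ in non-increasing order. For $x,y\in\mathbb R^N$, $x\succ y$ (equivalently $y\prec x$), ''$x$ majorizes $y$'', means $\sum_{i=1}^k x^{\downarrow}_i\ge\sum_{i=1}^k y^{\downarrow}_i$ for all $k=1,\dots,N$, with equality for $k=N$. A real square matrix is doubly stochastic if its entries are non-negative and all row and column sums equal $1$. *)

(* Defs.v *)
From mathcomp Require Import all_boot all_order all_algebra.
From mathcomp Require Import reals.
Set Implicit Arguments. Unset Strict Implicit. Unset Printing Implicit Defensive.
Import Order.TTheory GRing.Theory Num.Theory.
Local Open Scope ring_scope.

Definition downarr (R : realDomainType) (N : nat) (x : 'cV[R]_N) : seq R :=
  sort (fun a b : R => b <= a) [seq x i 0 | i <- enum 'I_N].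

Definition majorizes (R : realDomainType) (N : nat) (x y : 'cV[R]_N) : Prop :=
  (forall k : nat, (1 <= k <= N)%N ->
     \sum_(i < k) (downarr y)`_i <= \sum_(i < k) (downarr x)`_i) /\
  \sum_(i < N) (downarr x)`_i = \sum_(i < N) (downarr y)`_i.

Definition doubly_stochastic (R : realDomainType) (N : nat) (D : 'M[R]_N) : Prop :=
  (forall i j, 0 <= D i j) /\
  (forall i, \sum_(j < N) D i j = 1) /\
  (forall j, \sum_(i < N) D i j = 1).

(* Sequences are 0-indexed functions nat -> R: lambda_{j+1} in the paper is
   lam j here. The starred vectors of length N = n(n-1) list blocks:
   entry i of lam_star is lam (i / (n-1)), entry i of a mu-star is mu (i / n). *)
Definition lam_star (R : realDomainType) (n : nat) (lam : nat -> R) : 'cV[R]_(n * n.-1) :=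
  \col_(i < n * n.-1) lam (i %/ n.-1)%N.

Definition mu_star (R : realDomainType) (n : nat) (mu : nat -> R) : 'cV[R]_(n * n.-1) :=
  \col_(i < n * n.-1) mu (i %/ n)%N.

Definition nu_seq (R : realFieldType) (n : nat) (lam : nat -> R) : nat -> R :=
  fun j => (n.-1)%:R / n%:R * lam j.+1 + 1 / n%:R * lam 0%N.

(* Main.v *)
Require Import Defs.
From mathcomp Require Import all_boot all_order all_fingroup all_algebra.
From mathcomp Require Import reals complex ring zify.
Set Implicit Arguments. Unset Strict Implicit. Unset Printing Implicit Defensive.
Import Order.TTheory GRing.Theory Num.Theory.
Local Open Scope ring_scope.

(* Up to the factor n, q' is the characteristic polynomial of the compression of
   diag(lambda) to the hyperplane orthogonal to (1, ..., 1), so the spectral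
   theorem yields an orthonormal eigenbasis u_1, ..., u_(n-1) of that hyperplane
   with eigenvalues mu_k. The weights |u_kj|^2 satisfy
   mu_k = sum_j |u_kj|^2 lambda_j, with row sums 1 and column sums 1 - 1/n;
   repeating each of them in a block and dividing by n - 1 gives D.
   For the lower bound, Ky Fan's principle on the vectors of the hyperplane
   supported on the first m+1 coordinates gives
   mu_1 + ... + mu_m >= m/(m+1) (lambda_1 + ... + lambda_(m+1)), which dominates
   nu_1 + ... + nu_m because lambda_1 is the largest. *)

(** * Determinant and characteristic polynomial of the compression *)

(** Eliminating either diagonal block of the matrix with block rows (1, -v) and (u, 1) computes the
    same determinant in two ways. *)
Lemma det1Dmul (K : comNzRingType) n (u : 'cV[K]_n) (v : 'rV[K]_n) :
  \det (1%:M + u *m v) = 1 + (v *m u) 0 0.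
Proof.
have e1 : block_mx (1%:M : 'M_1) (- v) u 1%:M =
    block_mx 1%:M 0 u 1%:M *m block_mx 1%:M (- v) 0 (1%:M + u *m v).
  rewrite mulmx_block !mulmx1 !mul1mx !mul0mx !addr0 mulmxN.
  by rewrite addrCA addNr addr0.
have e2 : block_mx (1%:M : 'M_1) (- v) u 1%:M =
    block_mx (1%:M + v *m u) (- v) 0 1%:M *m block_mx 1%:M 0 u 1%:M.
  by rewrite mulmx_block !mulmx1 !mul1mx !mulmx0 !add0r mulNmx addrK.
have := congr1 determinant e1.
rewrite {1}e2 !det_mulmx !det_ublock !det_lblock !det1 !mul1r !mulr1 => <-.
by rewrite det_mx11 !mxE eqxx.
Qed.

(** The orthogonal projection onto the span of (1, ..., 1), when [n] is invertible. *)
Definition avg_mx (K : fieldType) n : 'M[K]_n := const_mx n%:R^-1.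

(* The compression of diag(y) to the orthogonal complement of (1, ..., 1),
   extended by the eigenvalue s on that vector. *)
Definition compress_mx (K : fieldType) n (y : 'I_n -> K) (s : K) : 'M[K]_n :=
  (1%:M - avg_mx K n) *m diag_mx (\row_j y j) *m (1%:M - avg_mx K n) +
  s *: avg_mx K n.

Section Compression.
Variables (K : fieldType) (n : nat).
Hypothesis n_neq0 : n%:R != 0 :> K.
Let E := avg_mx K n.
Let P : 'M[K]_n := 1%:M - E.

Lemma avg_mx_idem : E *m E = E.
Proof.
apply/matrixP=> i j; rewrite !mxE (eq_bigr (fun=> n%:R^-1 * n%:R^-1)).
  by rewrite sumr_const card_ord -[_ *+ n]mulr_natr divfK.
by move=> k _; rewrite !mxE.
Qed.

(** The product times the sum of inverses is the elementary symmetric polynomial of degree n - 1;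
    for y_j = x - lambda_j it is q'(x), which is how the derivative enters. *)
Lemma det_compress (y : 'I_n -> K) (s : K) : (forall j, y j != 0) ->
  \det (compress_mx y s) =
  s / n%:R * (\prod_j y j * \sum_j (y j)^-1).
Proof.
move=> y_neq0; rewrite /compress_mx -/E -/P; set Y := diag_mx _.
pose u : 'cV[K]_n := const_mx 1; pose v : 'rV[K]_n := const_mx n%:R^-1.
have EE : E = u *m v.
  by apply/matrixP=> i j; rewrite !mxE big_ord1 !mxE mul1r.
have vu : v *m u = 1%:M.
  apply/matrixP=> i j; rewrite !ord1 !mxE (eq_bigr (fun=> n%:R^-1)).
    by rewrite sumr_const card_ord -[_ *+ n]mulr_natr mulVf.
  by move=> k _; rewrite !mxE mulr1.
have EP : E *m P = 0 by rewrite mulmxBr mulmx1 avg_mx_idem subrr.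
have vP : v *m P = 0 by rewrite mulmxBr mulmx1 EE mulmxA vu mul1mx subrr.
(* The left factor is unipotent and the right one is a rank one perturbation
   of the identity, which leaves det (P Y + E) to compute. *)
have factorization : (1%:M + P *m Y *m E) *m (P *m Y *m P + s *: E) =
    (P *m Y + E) *m (P + s *: E).
  move: P EP => Q EQ; move: avg_mx_idem; rewrite -/E; move: E EQ => F FQ FF.
  rewrite mulmxDl mul1mx !mulmxDr !mulmxDl -!scalemxAr FQ addr0 FF.
  rewrite -!(mulmxA (Q *m Y)) FF (mulmxA F (_ *m _) Q) (mulmxA F Q Y) FQ.
  by rewrite !mul0mx !mulmx0 add0r addrAC -addrA.
have := congr1 determinant factorization; rewrite !det_mulmx.
have -> : \det (1%:M + P *m Y *m E) = 1.
  rewrite EE (mulmxA _ u) det1Dmul !mulmxA vP !mul0mx mxE addr0 //.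
have -> : P + s *: E = 1%:M + ((s - 1) *: u) *m v.
  by rewrite -scalemxAl -EE scalerBl scale1r /P addrAC -addrA.
rewrite det1Dmul -scalemxAr vu !mxE eqxx mulr1 (addrC 1) subrK mul1r => ->.
pose Z := diag_mx (\row_j (y j)^-1).
have ZY : Z *m Y = 1%:M.
  by rewrite mulmx_diag; apply/matrixP=> i j; rewrite !mxE mulVf.
(* Since E = E Z Y, the factor Y can be pulled out on the right; what remains is again a rank one
   perturbation of the identity. *)
have -> : P *m Y + E = (1%:M + u *m (v *m Z - v)) *m Y.
  rewrite /P mulmxBl mul1mx mulmxDl mul1mx mulmxBr mulmxA -EE mulmxBl -mulmxA.
  by rewrite ZY mulmx1 -addrA (addrC E).
rewrite det_mulmx det1Dmul det_diag.
have -> : 1 + ((v *m Z - v) *m u) 0 0 = (v *m Z *m u) 0 0.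
  rewrite mulmxBl vu; move: (_ *m u) => W.
  by rewrite !mxE eqxx addrCA subrr addr0.
have -> : (v *m Z *m u) 0 0 = n%:R^-1 * \sum_j (y j)^-1.
  rewrite mxE mulr_sumr; apply: eq_bigr => i _.
  by rewrite mul_mx_diag !mxE mulr1.
have -> : \prod_i (\row_j y j) 0 i = \prod_j y j.
  by apply: eq_bigr => i _; rewrite mxE.
by ring.
Qed.

(** P and E are complementary idempotents, so x splits as x P + x E. The characteristic matrix is
    thus itself of compression form and [det_compress] applies to it. *)
Lemma scalar_sub_compress (y : 'I_n -> K) (x s : K) :
  x%:M - compress_mx y s = compress_mx (fun j => x - y j) (x - s).
Proof.
rewrite /compress_mx -/E -/P.
have -> : diag_mx (\row_j (x - y j)) = x%:M - diag_mx (\row_j y j).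
  by apply/matrixP=> i j; rewrite !mxE mulrnBl.
have PP : P *m P = P.
  by rewrite {2}/P mulmxBr mulmx1 /P mulmxBl mul1mx avg_mx_idem subrr subr0.
have xE : x%:M = x *: P + x *: E by rewrite -scalerDr subrK scalemx1.
rewrite {1}xE {xE}; move: P PP => Q QQ.
rewrite mulmxBr mulmxBl mul_mx_scalar -scalemxAl QQ scalerBl.
by rewrite opprD addrACA.
Qed.

Lemma compress_mxE (y : 'I_n -> K) (s : K) i j :
  compress_mx y s i j = y i *+ (i == j) - (y i + y j) / n%:R +
    (\sum_k y k) / n%:R ^+ 2 + s / n%:R.
Proof.
rewrite /compress_mx -/E; set D := diag_mx _.
have ED : E *m D = \matrix_(i, j) (n%:R^-1 * y j).
  by apply/matrixP=> a b; rewrite mul_mx_diag !mxE.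
have DE : D *m E = \matrix_(i, j) (n%:R^-1 * y i).
  by apply/matrixP=> a b; rewrite mul_diag_mx !mxE mulrC.
have EDE : E *m D *m E = const_mx ((\sum_k y k) / n%:R ^+ 2).
  apply/matrixP=> a b; rewrite ED !mxE mulr_suml; apply: eq_bigr => k _.
  by rewrite !mxE; field.
rewrite !mulmxBl !mulmxBr !mul1mx !mulmx1 EDE ED DE !mxE.
by case: eqP => [->|_]; rewrite ?mulr1n ?mulr0n; field.
Qed.
End Compression.

Lemma map_compress (K L : fieldType) (f : {rmorphism K -> L}) n
    (y : 'I_n -> K) s :
  map_mx f (compress_mx y s) = compress_mx (fun j => f (y j)) (f s).
Proof.
have fE : map_mx f (avg_mx K n) = avg_mx L n.
  by apply/matrixP=> i j; rewrite !mxE fmorphV rmorph_nat.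
have fy : map_mx f (\row_j y j) = \row_j f (y j).
  by apply/matrixP=> i j; rewrite !mxE.
by rewrite /compress_mx map_mxD !map_mxM map_mxB map_mxZ map_diag_mx map_mx1 fE fy.
Qed.

Lemma mulf_logderiv (K : fieldType) (a q s : K) : a != 0 ->
  q + a * (q * s) = a * q * (a^-1 + s).
Proof. by move=> a_neq0; field. Qed.

Lemma divfMl (K : fieldType) (a b c : K) : a / b * c = b^-1 * (a * c).
Proof. by rewrite mulrAC mulrC. Qed.

(** The logarithmic derivative, taken in the fraction field so that every X - lambda_j is
    invertible. *)
Lemma deriv_prod_XsubC_frac (F : fieldType) n (lam : 'I_n -> F) :
  tofrac ((\prod_j ('X - (lam j)%:P))^`()) =
  tofrac (\prod_j ('X - (lam j)%:P)) * \sum_j (tofrac ('X - (lam j)%:P))^-1.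
Proof.
elim: (index_enum _) => [|j r IH].
  by rewrite !big_nil -polyC1 derivC mulr0 rmorph0.
rewrite !big_cons derivM derivXsubC mul1r rmorphD !rmorphM /= IH.
have : tofrac ('X - (lam j)%:P) != 0 by rewrite tofrac_eq0 polyXsubC_eq0.
exact: mulf_logderiv.
Qed.

(** Over the field of rational functions the entries X - lambda_j are nonzero, so [det_compress]
    covers repeated roots as well. *)
Lemma char_poly_compress (F : fieldType) n (lam : 'I_n -> F) t :
  n%:R != 0 :> F ->
  char_poly (compress_mx lam t) =
  n%:R^-1 *: (('X - t%:P) * (\prod_j ('X - (lam j)%:P))^`()).
Proof.
move=> n_neq0; apply/eqP; rewrite -tofrac_eq; apply/eqP.
pose f : {rmorphism F -> {fraction {poly F}}} := @tofrac {poly F} \o @polyC F.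
have fX p : tofrac ('X - p%:P) = tofrac 'X - f p by rewrite rmorphB.
have fn : f n%:R^-1 = n%:R^-1 by rewrite fmorphV rmorph_nat.
have fn0 : n%:R != 0 :> {fraction {poly F}} by rewrite -(rmorph_nat f) fmorph_eq0.
rewrite -mul_polyC !rmorphM /= deriv_prod_XsubC_frac -[tofrac n%:R^-1%:P]/(f _).
rewrite /char_poly -det_map_mx map_mxB map_scalar_mx -map_mx_comp.
rewrite (map_compress f) (scalar_sub_compress fn0) (det_compress fn0).
  rewrite -[f t]/(f t) -fX fn.
  rewrite rmorph_prod.
  under eq_bigr => j _ do rewrite -fX.
  under [X in _ * (_ * X) = _]eq_bigr => j _ do rewrite -fX.
  exact: divfMl.
by move=> j; rewrite -fX tofrac_eq0 polyXsubC_eq0.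
Qed.

(** * Unitary diagonalization with prescribed eigenvalues *)

Lemma char_poly_conj (K : comUnitRingType) n (U D : 'M[K]_n) : U \in unitmx ->
  char_poly (invmx U *m D *m U) = char_poly D.
Proof.
move=> U_unit; pose f := map_mx (@polyC K) : 'M_n -> 'M_n.
have VU : f (invmx U) *m f U = 1%:M by rewrite -map_mxM mulVmx // map_mx1.
rewrite /char_poly /char_poly_mx -/(f _).
have -> : 'X%:M - f (invmx U *m D *m U) =
    f (invmx U) *m ('X%:M - f D) *m f U.
  rewrite mulmxBr mulmxBl /f !map_mxM -/f; congr (_ - _).
  by rewrite mul_mx_scalar -scalemxAl VU scalemx1.
by rewrite !det_mulmx mulrAC -det_mulmx VU det1 mul1r.
Qed.

Local Open Scope sesquilinear_scope.

Lemma row_perm_unitary (C : numClosedFieldType) n (U : 'M[C]_n) (s : 'S_n) :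
  U \is unitarymx -> row_perm s U \is unitarymx.
Proof.
move=> /row_unitarymxP U_unitary; apply/row_unitarymxP => i j.
have rowE k : row k (row_perm s U) = row (s k) U by apply/rowP=> l; rewrite !mxE.
by rewrite !rowE U_unitary (inj_eq perm_inj).
Qed.

(** The spectral theorem leaves the order of the eigenvalues open. Comparing the linear factors of
    the characteristic polynomial gives a permutation matching [e], which is applied to the rows of
    the unitary matrix. *)
Lemma spectral_perm (C : numClosedFieldType) n (M : 'M[C]_n) (e : 'I_n -> C) :
  M \is normalmx -> char_poly M = \prod_i ('X - (e i)%:P) ->
  exists2 W : 'M[C]_n, W \is unitarymx &
    M = W^t* *m diag_mx (\row_i e i) *m W.
Proof.
move=> /orthomx_spectralP; set U := spectralmx M; set d := spectral_diag M.
have U_unitary : U \is unitarymx by exact: spectral_unitarymx.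
move=> ME; rewrite ME char_poly_conj ?unitarymx_unit //.
rewrite char_poly_trig ?diag_mx_is_trig // => eq_prod.
have : perm_eq [tuple e i | i < n] [tuple d 0 i | i < n].
  rewrite perm_sym; apply: prod_XsubC_eq; rewrite !big_tuple.
  under eq_bigr => i _ do rewrite tnth_mktuple.
  under [RHS]eq_bigr => i _ do rewrite tnth_mktuple.
  rewrite -eq_prod.
  by apply: eq_bigr => i _; rewrite mxE eqxx.
move=> /tuple_permP[s es]; exists (row_perm s U); first exact: row_perm_unitary.
have {}es i : e i = d 0 (s i).
  have := congr1 (nth 0 ^~ i) es.
  rewrite -!tnth_nth !tnth_mktuple.
  exact.
rewrite invmx_unitary //; apply/matrixP => a b; rewrite !mxE.
rewrite [RHS](reindex_inj (@perm_inj _ s^-1)).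
apply: eq_bigr => i _; rewrite !mul_mx_diag !mxE es permKV //.
Qed.

(** Index 0 carries the extra eigenvalue [t] and index k + 1 carries mu_k. The matrix is real
    symmetric, hence normal over [R[i]]. *)
Lemma critical_eigenbasis (R : rcfType) n (lam : 'I_n.+1 -> R) (mu : 'I_n -> R)
    (t : R) (e := fun i => oapp mu t (unlift ord0 i)) :
  (\prod_j ('X - (lam j)%:P))^`() = n.+1%:R *: \prod_k ('X - (mu k)%:P) ->
  exists2 W : 'M[R[i]]_n.+1, W \is unitarymx &
    map_mx (real_complex R) (compress_mx lam t) =
      W^t* *m diag_mx (\row_i (real_complex R (e i))) *m W.
Proof.
move=> crit; set M := map_mx _ _.
apply: spectral_perm.
  apply: symmetric_normalmx.
    apply/is_hermitianmxP; rewrite scale1r map_mx_id //.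
    apply/matrixP=> i j; rewrite [RHS]mxE [LHS]mxE [RHS]mxE.
    rewrite !compress_mxE ?pnatr_eq0 // eq_sym [lam j + _]addrC.
    by case: eqP => [->|].
  by apply/mxOverP => i j; rewrite mxE complex_real.
rewrite -map_char_poly char_poly_compress ?pnatr_eq0 // crit.
rewrite -scalerAr scalerA mulVf ?pnatr_eq0 // scale1r.
rewrite big_ord_recl rmorphM /= rmorph_prod /=.
congr (_ * _).
  by rewrite map_polyXsubC /e unlift_none.
by apply: eq_bigr => k _; rewrite map_polyXsubC /e liftK.
Qed.

(** * Eigenvectors orthogonal to (1, ..., 1) *)

(** The vector (1, ..., 1) is killed by 1 - E and fixed by E, hence an eigenvector for [s]. *)
Lemma sum_compress_mx (K : fieldType) n (y : 'I_n -> K) s i : n%:R != 0 :> K ->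
  \sum_j compress_mx y s i j = s.
Proof.
move=> n_neq0; rewrite (eq_bigr (fun j => y i *+ (i == j) +
  (- (y i / n%:R) - y j / n%:R + (\sum_k y k) / n%:R ^+ 2 + s / n%:R))).
  rewrite big_split /= (bigD1 i) //= eqxx mulr1n big1 ?addr0; last first.
    by move=> j /negPf ji; rewrite eq_sym ji.
  have cst (a : K) : \sum_(j < n) a = a * n%:R by rewrite sumr_const card_ord mulr_natr.
  rewrite !big_split /= !sumrN -!mulr_suml !cst.
  by move: (\sum_k y k) => S; field.
by move=> j _; rewrite compress_mxE // mulrDl opprD !addrA.
Qed.

Lemma complex_Re_sum (R : rcfType) (I : finType) (F : I -> R[i]) :
  complex.Re (\sum_i F i) = \sum_i complex.Re (F i).
Proof. by apply: (big_morph (@complex.Re R)) => [[a b] [c d]|]. Qed.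

Lemma complex_Re_conjM (R : rcfType) (z w : R[i]) :
  complex.Re (z^* * w) =
  complex.Re z * complex.Re w + complex.Im z * complex.Im w.
Proof. by case: z w => [a b] [c d] /=; rewrite mulNr opprK. Qed.

Lemma complex_Re_scale (R : rcfType) (a : R) (w : R[i]) :
  complex.Re (real_complex R a * w) = a * complex.Re w.
Proof. by case: w => [c d] /=; rewrite mul0r subr0. Qed.

(* x + iy has the eigenvectors u_k as rows, and G k is the real part of the
   projection onto u_k. *)
Lemma critical_gram (R : rcfType) n (lam : 'I_n.+1 -> R) (mu : 'I_n -> R) :
  (\prod_j ('X - (lam j)%:P))^`() = n.+1%:R *: \prod_k ('X - (mu k)%:P) ->
  exists x y : 'M[R]_(n, n.+1),
    let G k j l := x k j * x k l + y k j * y k l in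
    [/\ forall k, \sum_j G k j j = 1,
        forall k, \sum_j G k j j * lam j = mu k,
        forall j l, \sum_k G k j l = (j == l)%:R - n.+1%:R^-1 &
        forall j l, \sum_k mu k * G k j l = compress_mx lam 0 j l].
Proof.
move=> crit.
(* A value t outside the mu's makes (1, ..., 1) span a whole eigenspace, so the
   eigenvectors for the mu's have coordinate sum 0. *)
pose t := 1 + \sum_k `|mu k|.
have mu_t k : mu k != t.
  rewrite lt_eqF // /t (bigD1 k) //=; apply: le_lt_trans (ler_norm _) _.
  rewrite addrCA ltr_pwDr // ltr_pwDl // sumr_ge0 //.
have N0 : n.+1%:R != 0 :> R by rewrite pnatr_eq0.
have NC0 : n.+1%:R != 0 :> R[i] by rewrite pnatr_eq0.
have [W W_unitary] := critical_eigenbasis t crit.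
pose e i := oapp mu t (unlift ord0 i); rewrite -/e => WM.
pose w i j := W i j.
have e0 : e 0 = t by rewrite /e unlift_none.
have eS k : e (lift 0 k) = mu k by rewrite /e liftK.
pose M j l := real_complex R (compress_mx lam t j l).
have col_ortho j l : \sum_i (w i j)^* * w i l = (j == l)%:R.
  have : W^t* *m W = 1%:M.
    rewrite -invmx_unitary // mulVmx // unitarymx_unit //.
  move=> /matrixP/(_ j l); rewrite !mxE => <-.
  by apply: eq_bigr => i _; rewrite !mxE.
have row_norm i : \sum_j (w i j)^* * w i j = 1.
  have /unitarymxP/matrixP/(_ i i) := W_unitary.
  rewrite !mxE eqxx mulr1n => <-.
  by apply: eq_bigr => j _; rewrite !mxE mulrC.
have ME j l : M j l = \sum_i real_complex R (e i) * ((w i j)^* * w i l).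
  have /matrixP/(_ j l) := WM.
  rewrite mxE -/(M j l) mxE => ->.
  by apply: eq_bigr => i _; rewrite mul_mx_diag !mxE mulrA [_ * _^*]mulrC.
have eigen i l : \sum_j w i j * M j l = real_complex R (e i) * w i l.
  have : W *m map_mx (real_complex R) (compress_mx lam t) =
      diag_mx (\row_i (real_complex R (e i))) *m W.
    by rewrite WM !mulmxA (unitarymxP W_unitary) mul1mx.
  move=> /matrixP/(_ i l) WMil; transitivity ((W *m map_mx (real_complex R)
    (compress_mx lam t)) i l).
    by rewrite mxE; apply: eq_bigr => j _; rewrite [X in _ = _ * X]mxE.
  by rewrite WMil mul_diag_mx !mxE.
have Msum j : \sum_l M j l = real_complex R t.
  by rewrite /M -rmorph_sum sum_compress_mx.
pose s i := \sum_l w i l.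
(* Summing the eigenvector equation over all coordinates gives t s = mu_k s, and mu_k differs from
   t. *)
have sS k : s (lift 0 k) = 0.
  have : \sum_l \sum_j w (lift 0 k) j * M j l =
      real_complex R (mu k) * s (lift 0 k).
    by rewrite mulr_sumr; apply: eq_bigr => l _; rewrite eigen eS.
  rewrite exchange_big /=; under eq_bigr => j _ do rewrite -mulr_sumr Msum.
  rewrite -mulr_suml mulrC => /eqP; rewrite -subr_eq0 -mulrBl mulf_eq0.
  rewrite -rmorphB /= fmorph_eq0 subr_eq0 eq_sym (negPf (mu_t k)) /=.
  by move/eqP.
(* Summing the column orthogonality relation over [l] removes every row of coordinate sum 0. Only
   row 0 survives, so its entries are all equal. *)
have s0 j : (w 0 j)^* * s 0 = 1.
  have : \sum_l \sum_i (w i j)^* * w i l = 1.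
    under eq_bigr => l _ do rewrite col_ortho.
    rewrite (bigD1 j) //= eqxx big1 ?addr0 // => l /negPf lj.
    by rewrite eq_sym lj.
  rewrite exchange_big big_ord_recl /= -mulr_sumr [X in _ + X]big1 ?addr0 //.
  by move=> k _; rewrite -mulr_sumr -/(s _) sS mulr0.
have s0_neq0 : s 0 != 0.
  by apply/eqP => s00; have /eqP := s0 0; rewrite s00 mulr0 eq_sym oner_eq0.
have wc j : (w 0 j)^* = (s 0)^-1 by apply: (mulIf s0_neq0); rewrite s0 mulVf.
have w0 j l : (w 0 j)^* * w 0 l = n.+1%:R^-1.
  have -> : w 0 l = w 0 0.
    by apply: (inv_inj (@conjCK _)); rewrite !wc.
  have : \sum_l (w 0 l)^* * w 0 l = n.+1%:R * ((w 0 j)^* * w 0 0).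
    rewrite (eq_bigr (fun=> (w 0 j)^* * w 0 0)).
      by rewrite sumr_const card_ord mulr_natl.
    move=> i _; rewrite !wc; congr (_ * _).
    by apply: (inv_inj (@conjCK _)); rewrite !wc.
  rewrite row_norm => h; apply: (mulfI NC0); rewrite -h mulfV //.
pose x : 'M[R]_(n, n.+1) := \matrix_(k, j) complex.Re (w (lift 0 k) j).
pose y : 'M[R]_(n, n.+1) := \matrix_(k, j) complex.Im (w (lift 0 k) j).
have GE k j l : x k j * x k l + y k j * y k l =
    complex.Re ((w (lift 0 k) j)^* * w (lift 0 k) l).
  by rewrite !mxE complex_Re_conjM.
exists x, y => G; split.
- move=> k; under eq_bigr => j _ do rewrite /G GE.
  by rewrite -complex_Re_sum row_norm.
- move=> k; under eq_bigr => j _ do rewrite /G GE mulrC -complex_Re_scale.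
  rewrite -complex_Re_sum; set i := lift 0 k.
  suff -> : \sum_j real_complex R (lam j) * ((w i j)^* * w i j) =
     real_complex R (mu k) by [].
  have sc : \sum_j (w i j)^* = 0 by rewrite -rmorph_sum -/(s i) sS rmorph0.
  have : \sum_l (w i l)^* * (\sum_j w i j * M j l) = real_complex R (mu k).
    rewrite -[RHS]mulr1 -(row_norm i) mulr_sumr; apply: eq_bigr => l _.
    by rewrite eigen eS mulrCA.
  (* Terms of the compression constant in [j] vanish against a row of sum 0. It therefore acts as
     multiplication by lambda minus the constant [b], and [b] vanishes on pairing with the conjugate
     row. *)
  pose c := (\sum_k lam k) / n.+1%:R ^+ 2 + t / n.+1%:R.
  pose b := \sum_j w i j * (real_complex R (lam j) / n.+1%:R).
  have wM l : \sum_j w i j * M j l = real_complex R (lam l) * w i l - b.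
    rewrite (eq_bigr (fun j => w i j * (real_complex R (lam j) *+ (j == l)) -
      w i j * (real_complex R (lam j) / n.+1%:R) +
      w i j * real_complex R (c - lam l / n.+1%:R))).
      rewrite big_split sumrB /= -mulr_suml -/(s i) sS mul0r addr0; congr (_ - _).
      rewrite (bigD1 l) //= eqxx mulr1n big1 ?addr0 1?mulrC // => j /negPf ->.
      by rewrite mulr0n mulr0.
    move=> j _; rewrite -mulrBr -mulrDr; congr (_ * _).
    rewrite -(rmorph_nat (real_complex R)) -fmorphV -rmorphM -rmorphMn.
    rewrite -rmorphB -rmorphD; congr (real_complex R _).
    rewrite compress_mxE //= /c.
    by move: ((\sum_k lam k) / _) (n.+1%:R^-1) => S v; ring.
  under eq_bigr => l _ do rewrite wM mulrBr.
  rewrite sumrB -mulr_suml sc mul0r subr0 => <-.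
  by apply: eq_bigr => l _; rewrite mulrCA.
- move=> j l; under eq_bigr => k _ do rewrite /G GE.
  rewrite -complex_Re_sum.
  (* Row 0 contributes the constant 1/(n+1) to the identity matrix. *)
  have := col_ortho j l; rewrite big_ord_recl w0 => /(canRL (addKr _)) ->.
  rewrite -!(rmorph_nat (real_complex R)) -fmorphV -rmorphN -rmorphD /=.
  by rewrite addrC.
- move=> j l; under eq_bigr => k _ do rewrite /G GE -complex_Re_scale.
  rewrite -complex_Re_sum.
  (* Row 0 contributes t/(n+1), exactly the term by which the compressions with s = t and s = 0
     differ. *)
  have := ME j l; rewrite big_ord_recl w0 e0.
  under [X in _ = _ + X]eq_bigr => k _ do rewrite eS.
  move/(canLR (addKr _)) <-.
  rewrite -!(rmorph_nat (real_complex R)) -fmorphV -rmorphM -rmorphN -rmorphD /=.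
  by rewrite !compress_mxE // addrC mul0r addr0 addrK.
Qed.

(** * Weighted sums and majorization of non-increasing sequences *)

Lemma weighted_sum_le (R : realDomainType) N (x : nat -> R) (c : 'I_N -> R) k :
  (k <= N)%N -> (forall i j, (i <= j < N)%N -> x j <= x i) ->
  (forall i, 0 <= c i <= 1) -> \sum_i c i = k%:R ->
  \sum_i c i * x i <= \sum_(i < k) x i.
Proof.
case: N c => [|N] c kN x_noninc c01 sum_c.
  by move: kN; rewrite leqn0 => /eqP ->; rewrite !big_ord0.
(* Both weight families have total k, so subtracting the pivot [p] changes nothing, and then each
   term is nonpositive. The minimum keeps the index in range when k is the full length N + 1. *)
pose p := x (minn k N).
have sumk (f : nat -> R) : \sum_(i < k) f i = \sum_(i < N.+1) (i < k)%N%:R * f i.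
  rewrite (big_ord_widen _ f kN) big_mkcond; apply: eq_bigr => i _.
  by case: ifP; rewrite ?mul1r ?mul0r.
rewrite -subr_le0 sumk.
suff : \sum_(i < N.+1) (c i - (i < k)%N%:R) * (x i - p) <= 0.
  rewrite (eq_bigr (fun i : 'I__ => (c i * x i - (i < k)%N%:R * x i) -
    (c i - (i < k)%N%:R * 1) * p)); last by move=> i _; ring.
  rewrite !sumrB -mulr_suml sumrB sum_c -(sumk (fun=> 1)).
  by rewrite sumr_const card_ord subrr mul0r subr0.
apply: sumr_le0 => i _; have /andP[c0 c1] := c01 i.
have [ik|ki] := ltnP i k.
  rewrite mulr_le0_ge0 ?subr_le0 ?subr_ge0 // x_noninc //.
  by have := ltn_ord i; lia.
rewrite subr0 mulr_ge0_le0 // subr_le0 x_noninc //.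
by have := ltn_ord i; lia.
Qed.

Lemma nth_downarr (R : realDomainType) N (x : nat -> R) i : (i < N)%N ->
  (forall i j, (i <= j < N)%N -> x j <= x i) ->
  (downarr (\col_(i < N) x i))`_i = x i.
Proof.
move=> iN x_noninc.
have -> : downarr (\col_(i < N) x i) = [seq x i | i <- iota 0 N].
  rewrite /downarr (eq_map (g := fun j : 'I_N => x j)); last by move=> j; rewrite mxE.
  rewrite (map_comp x val) val_enum_ord; apply: sorted_sort.
    by move=> a b c /[swap]; apply: le_trans.
  apply/(sortedP 0) => j; rewrite size_map size_iota => jN.
  by rewrite !(nth_map 0%N) ?size_iota ?nth_iota ?x_noninc; lia.
by rewrite (nth_map 0%N) ?size_iota // nth_iota.
Qed.

Lemma majorizes_col (R : realDomainType) N (x y : nat -> R) :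
  (forall i j, (i <= j < N)%N -> x j <= x i) ->
  (forall i j, (i <= j < N)%N -> y j <= y i) ->
  (forall k, (k <= N)%N -> \sum_(i < k) y i <= \sum_(i < k) x i) ->
  \sum_(i < N) x i = \sum_(i < N) y i ->
  majorizes (\col_(i < N) x i) (\col_(i < N) y i).
Proof.
move=> x_noninc y_noninc le_xy eq_xy; split.
  move=> k /andP[_ kN]; have lt (i : 'I_k) : (i < N)%N by exact: leq_trans kN.
  rewrite (eq_bigr (fun i : 'I_k => y i)) => [|i _]; last by rewrite nth_downarr.
  rewrite [leRHS](eq_bigr (fun i : 'I_k => x i)) => [|i _]; last by rewrite nth_downarr.
  exact: le_xy.
rewrite (eq_bigr (fun i : 'I_N => x i)) => [|i _]; last by rewrite nth_downarr.
by rewrite eq_xy; apply: eq_bigr => i _; rewrite nth_downarr.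
Qed.

(** The first k rows of D add up to weights in [0, 1] of total k, so a partial sum of y is a
    weighted sum of x bounded by [weighted_sum_le]. *)
Lemma doubly_stochastic_majorizes (R : realDomainType) N (x y : nat -> R)
    (D : 'M[R]_N) :
  (forall i j, (i <= j < N)%N -> x j <= x i) ->
  (forall i j, (i <= j < N)%N -> y j <= y i) ->
  doubly_stochastic D -> \col_(i < N) y i = D *m \col_(i < N) x i ->
  majorizes (\col_(i < N) x i) (\col_(i < N) y i).
Proof.
move=> x_noninc y_noninc [D_ge0 [D_row D_col]] yD.
have yE (i : 'I_N) : y i = \sum_j D i j * x j.
  have /colP/(_ i) := yD; rewrite !mxE => ->.
  by apply: eq_bigr => j _; rewrite mxE.
apply: majorizes_col => // [k kN|]; last first.
  under [RHS]eq_bigr => i _ do rewrite yE.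
  by rewrite exchange_big; apply: eq_bigr => j _; rewrite -mulr_suml D_col mul1r.
pose c (j : 'I_N) := \sum_(i < k) D (widen_ord kN i) j.
have -> : \sum_(i < k) y i = \sum_j c j * x j.
  under [RHS]eq_bigr => j _ do rewrite mulr_suml.
  by rewrite exchange_big; apply: eq_bigr => i _; rewrite (yE (widen_ord kN i)).
apply: weighted_sum_le => // [j|].
  rewrite sumr_ge0 //= -(D_col j) /c; pose F i := D i j.
  rewrite -(big_ord_narrow (F := F) kN) [leRHS](bigID (fun i : 'I_N => i < k)%N) /=.
  by rewrite lerDl sumr_ge0.
rewrite exchange_big /= (eq_bigr (fun=> 1)) ?sumr_const ?card_ord //.
Qed.

(** * Partial sums of block sequences *)

Lemma sum_divn (R : pzRingType) (g : nat -> R) n a r : (r <= n)%N ->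
  \sum_(i < a * n + r) g (i %/ n)%N = n%:R * \sum_(i < a) g i + r%:R * g a.
Proof.
have block m s : (s <= n)%N ->
    \sum_(i < s) g ((m * n + i) %/ n)%N = s%:R * g m.
  move=> sn; rewrite (eq_bigr (fun=> g m)) ?sumr_const ?card_ord ?mulr_natl //.
  move=> i _; rewrite divnMDl; last by have := ltn_ord i; lia.
  by rewrite divn_small ?addn0 //; have := ltn_ord i; lia.
move=> rn; rewrite big_split_ord /= block //; congr (_ + _).
elim: a => [|a IH]; first by rewrite !big_ord0 mulr0.
rewrite mulSnr big_split_ord /= IH block // big_ord_recr mulrDr //.
Qed.

Lemma sum_divn_full (R : pzRingType) (g : nat -> R) n a :
  \sum_(i < a * n) g (i %/ n)%N = n%:R * \sum_(i < a) g i.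
Proof. by rewrite -[(a * n)%N]addn0 sum_divn // mul0r addr0. Qed.

(** Inside a block the partial sum interpolates linearly between its values at the two ends, so
    block boundaries decide the sign. *)
Lemma sum_divn_ge0 (R : realDomainType) (g : nat -> R) n a k :
  (forall m, (m <= a)%N -> 0 <= \sum_(i < m) g i) -> (k <= a * n)%N ->
  0 <= \sum_(i < k) g (i %/ n)%N.
Proof.
move=> g_ge0; case: n => [|n].
  by rewrite muln0 leqn0 => /eqP ->; rewrite big_ord0.
move=> kan; have kn : (k %/ n.+1 <= a)%N by rewrite -(mulnK a (ltn0Sn n)) leq_div2r.
have rn : (k %% n.+1 < n.+1)%N by rewrite ltn_mod.
move: kan; rewrite (divn_eq k n.+1); move: (k %/ _)%N (k %% _)%N kn rn => m r ma rn man.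
rewrite sum_divn; last exact: ltnW.
have [r0|r_gt0] := posnP r.
  by rewrite r0 mul0r addr0 mulr_ge0 ?g_ge0.
have -> : n.+1%:R * \sum_(i < m) g i + r%:R * g m =
   (n.+1 - r)%:R * \sum_(i < m) g i + r%:R * \sum_(i < m.+1) g i.
  by rewrite big_ord_recr /= natrB 1?ltnW //; ring.
by rewrite addr_ge0 ?mulr_ge0 ?g_ge0 //; nia.
Qed.

(** * The Ky Fan lower bound for sums of critical points *)

(** Cauchy-Schwarz, from the nonnegative sum of squared deviations from the mean S/q. *)
Lemma sqr_sum_le (R : realFieldType) (I : finType) (J : {set I}) (a : I -> R) :
  (\sum_(j in J) a j) ^+ 2 <= #|J|%:R * \sum_(j in J) a j ^+ 2.
Proof.
have [->|J_neq0] := eqVneq J set0; first by rewrite !big_set0 cards0 mul0r expr0n.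
have q_gt0 : 0 < #|J|%:R :> R by rewrite ltr0n card_gt0.
set S := \sum_(j in J) a j; set q := #|J|%:R in q_gt0 *.
have : 0 <= \sum_(j in J) (a j - S / q) ^+ 2 by apply: sumr_ge0 => j _; exact: sqr_ge0.
rewrite (eq_bigr (fun j => a j ^+ 2 - a j * (2 * S / q) + (S / q) ^+ 2)); last first.
  by move=> j _; ring.
rewrite big_split sumrB /= -mulr_suml sumr_const -/S -[_ *+ #|J|]mulr_natr -/q.
set T := \sum_(j in J) _ => h; rewrite -subr_ge0.
have -> : q * T - S ^+ 2 = q * (T - S * (2 * S / q) + (S / q) ^+ 2 * q).
  by field; rewrite gt_eqF.
by rewrite mulr_ge0 // ltW.
Qed.

(** The left side is the trace of B compressed to the vectors supported on J with sum 0; this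
    compression annihilates b_i + b_j + c. *)
Lemma sum_minus_mean (K : fieldType) (I : finType) (J : {set I}) (a b : I -> K)
    (c : K) : #|J|%:R != 0 :> K ->
  let B i j := a i *+ (i == j) + b i + b j + c in
  \sum_(i in J) B i i - #|J|%:R^-1 * \sum_(i in J) \sum_(j in J) B i j =
    (1 - #|J|%:R^-1) * \sum_(i in J) a i.
Proof.
move=> q_neq0 B; set q := #|J|%:R in q_neq0 *.
have cst (s : K) : \sum_(i in J) s = s * q by rewrite sumr_const -mulr_natr.
have rowE i : i \in J -> \sum_(j in J) B i j = a i + b i * q + \sum_(j in J) b j + c * q.
  move=> iJ; rewrite !big_split /= !cst (bigD1 i) //= eqxx mulr1n big1 ?addr0 //.
  by move=> j /andP[_ /negPf ji]; rewrite eq_sym ji.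
rewrite (eq_bigr _ rowE) (eq_bigr (fun i => a i + (b i + b i) + c)); last first.
  by move=> i _; rewrite /B eqxx mulr1n addrA.
rewrite !big_split /= !cst -mulr_suml.
by field.
Qed.

(** The trace on an m-dimensional subspace is a combination of the mu_k with weights in [0, 1] of
    total m, hence at most the sum of the m largest. *)
Lemma top_critical_sum (R : rcfType) n (lam mu : nat -> R) m :
  (forall i j, (i <= j < n)%N -> mu j <= mu i) ->
  (\prod_(j < n.+1) ('X - (lam j)%:P))^`() =
    n.+1%:R *: \prod_(k < n) ('X - (mu k)%:P) ->
  (m <= n)%N ->
  (1 - m.+1%:R^-1) * \sum_(j < m.+1) lam j <= \sum_(k < m) mu k.
Proof.
move=> mu_noninc crit mn.
have [x [y]] := critical_gram crit; set G := fun k j l => _.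
move=> [G_row _ G_col G_mu].
pose J := [set j : 'I_n.+1 | (j < m.+1)%N].
have cardJ : #|J| = m.+1.
  rewrite -sum1_card (eq_bigl (fun j : 'I_n.+1 => j < m.+1)%N) => [|j]; last by rewrite inE.
  by rewrite -(big_ord_widen _ (fun=> 1%N)) // sum1_card card_ord.
have sumJ (f : nat -> R) : \sum_(j < m.+1) f j = \sum_(j in J) f j.
  by rewrite (big_ord_widen n.+1) //; apply: eq_bigl => j; rewrite inE.
have q_neq0 : #|J|%:R != 0 :> R by rewrite cardJ pnatr_eq0.
have n_neq0 : n.+1%:R != 0 :> R by rewrite pnatr_eq0.
(* c k is the squared norm of the projection of u_k onto the vectors supported
   on J with coordinate sum 0. *)
pose c k := \sum_(j in J) G k j j - #|J|%:R^-1 * \sum_(j in J) \sum_(l in J) G k j l.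
have GG k : \sum_(j in J) \sum_(l in J) G k j l =
    (\sum_(j in J) x k j) ^+ 2 + (\sum_(j in J) y k j) ^+ 2.
  rewrite !expr2 !big_distrl -big_split; apply: eq_bigr => j _ /=.
  by rewrite !big_distrr -big_split.
rewrite sumJ -cardJ.
(* Both sides are the trace of the compression on that subspace; off the diagonal its entries have
   only the terms that [sum_minus_mean] cancels. *)
have -> : (1 - #|J|%:R^-1) * \sum_(j in J) lam j = \sum_k c k * mu k.
  have := sum_minus_mean (fun j : 'I__ => lam j)
    (fun j : 'I__ => - (lam j / n.+1%:R)) ((\sum_(k < n.+1) lam k) / n.+1%:R ^+ 2) q_neq0.
  move=> /= <-.
  have cE k : c k * mu k = \sum_(j in J) mu k * G k j j -
      #|J|%:R^-1 * \sum_(j in J) \sum_(l in J) mu k * G k j l.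
    rewrite /c mulrC mulrBr mulrCA !mulr_sumr; congr (_ - _).
    by apply: eq_bigr => j _; rewrite !mulr_sumr.
  under [RHS]eq_bigr => k _ do rewrite cE.
  have entry (j l : 'I_n.+1) : \sum_(k < n) mu k * G k j l = lam j *+ (j == l) +
      - (lam j / n.+1%:R) + - (lam l / n.+1%:R) + (\sum_(k < n.+1) lam k) / n.+1%:R ^+ 2.
    by rewrite G_mu compress_mxE // mul0r addr0 mulrDl opprD !addrA.
  rewrite [RHS]sumrB -[in RHS]mulr_sumr; congr (_ - _ * _).
    by rewrite [RHS]exchange_big; apply: eq_bigr => j _; rewrite entry.
  rewrite [RHS]exchange_big; apply: eq_bigr => j _ /=.
  by rewrite [RHS]exchange_big; apply: eq_bigr => l _ /=; rewrite entry.
(* Nonnegativity of c_k is Cauchy-Schwarz for the real and imaginary parts; c_k is at most 1 because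
   u_k has norm 1. *)
apply: weighted_sum_le => // [k|].
  rewrite /c GG; apply/andP; split.
    rewrite subr_ge0 mulrC ler_pdivrMr ?ltr0n ?cardJ // -cardJ mulrC.
    have -> : \sum_(j in J) G k j j =
        \sum_(j in J) x k j ^+ 2 + \sum_(j in J) y k j ^+ 2 by rewrite -big_split.
    by rewrite mulrDr lerD // sqr_sum_le.
  rewrite -[leRHS](G_row k) [leRHS](bigID (mem J)) /= lerBlDr -addrA lerDl addr_ge0 //.
    by apply: sumr_ge0 => j _; rewrite addr_ge0 // -expr2 sqr_ge0.
  by rewrite mulr_ge0 ?invr_ge0 // addr_ge0 // sqr_ge0.
(* The same trace with all eigenvalues mu_k replaced by 1 gives the total weight |J| - 1 = m. *)
have := sum_minus_mean (fun j : 'I_n.+1 => 1) (fun=> 0) (- n.+1%:R^-1) q_neq0.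
have entry j l : \sum_k G k j l = 1 *+ (j == l) + 0 + 0 + - n.+1%:R^-1.
  by rewrite G_col !addr0.
rewrite sumr_const mulrBl mulVf // mul1r => cQ.
have -> : m%:R = #|J|%:R - 1 :> R by rewrite cardJ -addn1 natrD addrK.
rewrite -cQ /c sumrB -mulr_sumr; congr (_ - _ * _).
  by rewrite exchange_big; apply: eq_bigr => j _; rewrite entry.
rewrite exchange_big; apply: eq_bigr => j _ /=.
by rewrite exchange_big; apply: eq_bigr => l _ /=; rewrite entry.
Qed.

(** * Comparison with the sequence nu *)

(** With Q the sum of lambda over indices 1 to m, counted from 0, the difference is a nonnegative
    multiple of (n - m)(m lambda_0 - Q). *)
Lemma nu_sum_le (R : realFieldType) n (lam : nat -> R) m :
  (forall i j, (i <= j < n.+1)%N -> lam j <= lam i) -> (m <= n)%N ->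
  \sum_(j < m) nu_seq n.+1 lam j <= (1 - m.+1%:R^-1) * \sum_(j < m.+1) lam j.
Proof.
move=> lam_noninc mn; rewrite /nu_seq /= big_split -mulr_sumr sumr_const card_ord.
rewrite big_ord_recl /=; set Q := \sum_(i < m) _.
have Q_le : Q <= m%:R * lam 0%N.
  rewrite mulr_natl -[m in leRHS]card_ord -sumr_const; apply: ler_sum => i _.
  by apply: lam_noninc; have := ltn_ord i; lia.
have m1 : m.+1%:R = m%:R + 1 :> R by rewrite -addn1 natrD.
have n1 : n.+1%:R = n%:R + 1 :> R by rewrite -addn1 natrD.
have m0 : 0 <= m%:R :> R by [].
have n0 : 0 <= n%:R :> R by [].
have mnR : m%:R <= n%:R :> R by rewrite ler_nat.
rewrite -subr_ge0 -[_ *+ m]mulr_natr m1 n1.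
have -> : (1 - (m%:R + 1)^-1) * (lam 0%N + Q) -
  (n%:R / (n%:R + 1) * Q + 1 / (n%:R + 1) * lam 0%N * m%:R) =
  (n%:R - m%:R) / ((n%:R + 1) * (m%:R + 1)) * (m%:R * lam 0%N - Q).
  by field; rewrite !gt_eqF // ltr_wpDl.
rewrite mulr_ge0 ?subr_ge0 // divr_ge0 ?subr_ge0 // mulr_ge0 // ltW // ltr_wpDl //.
Qed.

(** * Weights, total sums and the doubly stochastic matrix *)

(** S k j is the squared modulus of the j-th coordinate of the eigenvector u_k. *)
Lemma critical_weights (R : rcfType) n (lam : 'I_n.+1 -> R) (mu : 'I_n -> R) :
  (\prod_j ('X - (lam j)%:P))^`() = n.+1%:R *: \prod_k ('X - (mu k)%:P) ->
  exists S : 'M[R]_(n, n.+1),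
    [/\ forall k j, 0 <= S k j, forall k, \sum_j S k j = 1,
        forall j, \sum_k S k j = 1 - n.+1%:R^-1 &
        forall k, mu k = \sum_j S k j * lam j].
Proof.
move=> /critical_gram[x [y] [G_row G_lam G_col _]].
exists (\matrix_(k, j) (x k j * x k j + y k j * y k j)); split.
- by move=> k j; rewrite mxE addr_ge0 // -expr2 sqr_ge0.
- by move=> k; rewrite -[RHS](G_row k); apply: eq_bigr => j _; rewrite mxE.
- move=> j; have := G_col j j; rewrite eqxx => <-.
  by apply: eq_bigr => k _; rewrite mxE.
- by move=> k; rewrite -[LHS](G_lam k); apply: eq_bigr => j _; rewrite mxE.
Qed.

Lemma critical_sum (R : rcfType) n (lam : 'I_n.+1 -> R) (mu : 'I_n -> R) :
  (\prod_j ('X - (lam j)%:P))^`() = n.+1%:R *: \prod_k ('X - (mu k)%:P) ->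
  \sum_k mu k = (1 - n.+1%:R^-1) * \sum_j lam j.
Proof.
move=> /critical_weights[S [_ _ S_col muE]].
rewrite (eq_bigr _ (fun k _ => muE k)) exchange_big mulr_sumr.
by apply: eq_bigr => j _; rewrite -mulr_suml S_col.
Qed.

Lemma nu_sum (R : realFieldType) n (lam : nat -> R) :
  \sum_(j < n) nu_seq n.+1 lam j = (1 - n.+1%:R^-1) * \sum_(j < n.+1) lam j.
Proof.
rewrite /nu_seq /= big_split -mulr_sumr sumr_const card_ord.
rewrite big_ord_recl /=; set Q := \sum_(i < n) _.
have n1 : n.+1%:R = n%:R + 1 :> R by rewrite -addn1 natrD.
rewrite -[_ *+ n]mulr_natr n1.
by field; rewrite gt_eqF // ltr_wpDl.
Qed.

Lemma divn_block_noninc (R : realDomainType) (f : nat -> R) n a :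
  (forall i j, (i <= j < a)%N -> f j <= f i) ->
  forall i j, (i <= j < a * n)%N -> f (j %/ n)%N <= f (i %/ n)%N.
Proof.
move=> f_noninc i j /andP[ij jan]; apply: f_noninc.
rewrite leq_div2r //= ltn_divLR //; case: n jan => [|//].
by rewrite muln0.
Qed.

(** Entries of D are those of S repeated in blocks and divided by n. A row meets n + 1 blocks of
    width n, giving 1; a column meets n blocks of height n + 1, giving (n+1)(1 - 1/(n+1))/n = 1. *)
Lemma block_doubly_stochastic (R : realFieldType) n (S : 'M[R]_(n, n.+1))
    (lam mu : nat -> R) : (0 < n)%N ->
  (forall k j, 0 <= S k j) -> (forall k, \sum_j S k j = 1) ->
  (forall j, \sum_k S k j = 1 - n.+1%:R^-1) ->
  (forall k : 'I_n, mu k = \sum_j S k j * lam j) ->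
  exists D : 'M[R]_(n.+1 * n),
    doubly_stochastic D /\ mu_star n.+1 mu = D *m lam_star n.+1 lam.
Proof.
case: n S => // n S _ S_ge0 S_row S_col muE.
pose D : 'M[R]_(n.+2 * n.+1) := \matrix_(i, j)
  (S (inord (i %/ n.+2)) (inord (j %/ n.+1)) / n.+1%:R).
have N1 : n.+1%:R != 0 :> R by rewrite pnatr_eq0.
have N2 : n.+2%:R != 0 :> R by rewrite pnatr_eq0.
exists D; split; first (split; last split).
- by move=> i j; rewrite mxE divr_ge0.
- move=> i; under eq_bigr => j _ do rewrite mxE.
  rewrite (sum_divn_full (fun j => S _ (inord j) / n.+1%:R)) -mulr_suml mulrC divfK //.
  by rewrite -[RHS](S_row (inord (i %/ n.+2))); apply: eq_bigr => j _; rewrite inord_val.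
- move=> j; under eq_bigr => i _ do rewrite mxE.
  have := sum_divn_full (fun i => S (inord i) (inord (j %/ n.+1)) / n.+1%:R) n.+2 n.+1.
  rewrite mulnC => ->; rewrite -mulr_suml.
  rewrite (eq_bigr (fun k => S k (inord (j %/ n.+1)))); last first.
    by move=> k _; rewrite inord_val.
  rewrite S_col; have n2 : n.+2%:R = n.+1%:R + 1 :> R by rewrite -addn1 natrD.
  rewrite mulrA mulrBr mulr1 mulfV // n2 addrK mulfV //.
apply/colP => i; rewrite !mxE.
under eq_bigr => j _ do rewrite !mxE /=.
rewrite (sum_divn_full (fun j => S _ (inord j) / n.+1%:R * lam j)) mulr_sumr.
have iN : (i %/ n.+2 < n.+1)%N by rewrite ltn_divLR //; have := ltn_ord i; rewrite /=; lia.
rewrite -{1}(inordK iN) muE; apply: eq_bigr => j _.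
rewrite inord_val. by rewrite mulrA mulrCA divff // mulr1.
Qed.

(** * The two majorizations and the matrix D *)

Theorem theorem2p6 (R : realType) (n : nat) (lam mu : nat -> R) :
  (2 <= n)%N ->
  (forall i j : nat, (i <= j < n)%N -> lam j <= lam i) ->
  (forall i j : nat, (i <= j < n.-1)%N -> mu j <= mu i) ->
  (\prod_(j < n) ('X - (lam j)%:P))^`() = n%:R *: \prod_(k < n.-1) ('X - (mu k)%:P) ->
  majorizes (mu_star n mu) (mu_star n (nu_seq n lam)) /\
  majorizes (lam_star n lam) (mu_star n mu) /\
  exists D : 'M[R]_(n * n.-1),
    doubly_stochastic D /\ mu_star n mu = D *m lam_star n lam.
Proof.
case: n => [//|[//|n]] _ lam_noninc mu_noninc crit.
have mu_star_noninc : forall i j, (i <= j < n.+2 * n.+1)%N ->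
    mu (j %/ n.+2)%N <= mu (i %/ n.+2)%N.
  by rewrite mulnC; apply: divn_block_noninc.
have [S [S_ge0 S_row S_col muE]] := critical_weights crit.
have [D [D_ds D_mu]] := block_doubly_stochastic (isT : 0 < n.+1)%N S_ge0 S_row S_col muE.
split; last first.
  split; last by exists D.
  have lam_star_noninc := divn_block_noninc (n := n.+1) lam_noninc.
  exact: (doubly_stochastic_majorizes lam_star_noninc mu_star_noninc D_ds D_mu).
apply: (majorizes_col (y := fun i => nu_seq n.+2 lam (i %/ n.+2)%N) mu_star_noninc).
- rewrite mulnC; apply: divn_block_noninc => i j /andP[ij jn].
  rewrite /nu_seq lerD2r ler_wpM2l ?divr_ge0 //.
  by apply: lam_noninc; lia.
- move=> k kN; rewrite -subr_ge0 -sumrB.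
  (* Both vectors have blocks of the same length, so partial sums need comparing only at block
     boundaries. *)
  apply: (sum_divn_ge0 (g := fun i => mu i - nu_seq n.+2 lam i)
    (n := n.+2) (a := n.+1)); last first.
    by rewrite mulnC.
  move=> m mn; rewrite sumrB subr_ge0.
  exact: le_trans (nu_sum_le lam_noninc mn) (top_critical_sum mu_noninc crit mn).
- have := sum_divn_full mu n.+2 n.+1.
  have := sum_divn_full (nu_seq n.+2 lam) n.+2 n.+1.
  rewrite /= [(n.+1 * n.+2)%N]mulnC => -> ->; congr (_ * _).
  by rewrite nu_sum (critical_sum crit).
Qed.
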